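(* Let $\mathcal C$ be a parsummable category. (i) For every injection $\varphi:\{1,2\}\times\omega\to\omega$, the functor $\varphi_*:\mathcal C\times\mathcal C\to\mathcal C$ together with the associativity isomorphisms $[\varphi(1+\varphi),\varphi(\varphi+1)]^{x,y,z}$, symmetry isomorphisms $[\varphi t,\varphi]^{x,y}$ and right unit isomorphisms $[\varphi^1,1]^x$ make the underlying category of $\mathcal C$ into a symmetric monoidal category with unit object $0$, denoted $\varphi^*(\mathcal C)$. (ii) For all injections $\varphi,\psi:\{1,2\}\times\omega\to\omega$, the natural isomorphism $[\psi,\varphi]:\varphi_*\Rightarrow\psi_*$ makes the identity functor of $\mathcal C$ into a strong symmetric monoidal functor from the symmetric monoidal category $\varphi^*(\mathcal C)$ to the symmetric monoidal category $\psi^*(\mathcal C)$.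
   Context: Let $\omega=\{0,1,2,\dots\}$ and let $M$ be the monoid, under composition, of injective maps $\omega\to\omega$. For a set $X$, $EX$ denotes the category with object set $X$ and exactly one morphism, written $(y,x):x\to y$, between any two objects. Then $\mathcal M=EM$ is a strict monoidal category. An $\mathcal M$-category is a small category $\mathcal C$ with a strict (strictly associative and unital) action functor $\mathcal M\times\mathcal C\to\mathcal C$; morphisms are functors commuting strictly with the actions. For $u,v\in M$ write $u_*:\mathcal C\to\mathcal C$ for the action of $u$ and $[v,u]^x:u_*(x)\to v_*(x)$ for the isomorphism given by acting with $(v,u)$ on $1_x$. An object $x$ is supported on $A\subseteq\omega$ if $u_*(x)=x$ for every $u\in M$ that is the identity on $A$; it is finitely supported if it is supported on some finite set. $\mathcal C$ is tame if all its objects are finitely supported. The box product $\mathcal C\boxtimes\mathcal D$ of $\mathcal M$-categories is the full subcategory of $\mathcal C\times\mathcal D$ (diagonal $\mathcal M$-action) on the pairs $(c,d)$ such that $c$ is supported on $A$ and $d$ on $B$ for some disjoint $A,B\subseteq\omega$; it is a symmetric monoidal product on tame $\mathcal M$-categories with unit the terminal category. A parsummable category is a commutative monoid for $\boxtimes$ in tame $\mathcal M$-categories: a tame $\mathcal M$-category $\mathcal C$ with an $\mathcal M$-equivariant functor $+:\mathcal C\boxtimes\mathcal C\to\mathcal C$ that is strictly associative, commutative and unital, with unit an object $0$ fixed by $\mathcal M$. For $m\ge0$ and an injection $\chi:\{1,\dots,m\}\times\omega\to\omega$ write $\chi^i=\chi(i,-):\omega\to\omega$. Since the images of the $\chi^i$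 are pairwise disjoint, there is a functor $\chi_*:\mathcal C^m\to\mathcal C$ given on objects and morphisms by $\chi_*(f_1,\dots,f_m)=\sum_{i=1}^m\chi^i_*(f_i)$. For another injection $\psi:\{1,\dots,m\}\times\omega\to\omega$ the natural isomorphism $[\psi,\chi]:\chi_*\Rightarrow\psi_*$ is $[\psi,\chi]^{x_1,\dots,x_m}=\sum_{i=1}^m[\psi^i,\chi^i]^{x_i}$. For $\varphi:\{1,2\}\times\omega\to\omega$, the injections $\varphi(\varphi+1),\varphi(1+\varphi):\{1,2,3\}\times\omega\to\omega$ are as follows: $\varphi(\varphi+1)$ sends $(1,j),(2,j),(3,j)$ to $\varphi(1,\varphi(1,j)),\varphi(1,\varphi(2,j)),\varphi(2,j)$; $\varphi(1+\varphi)$ sends them to $\varphi(1,j),\varphi(2,\varphi(1,j)),\varphi(2,\varphi(2,j))$. The map $t$ is the involution of $\{1,2\}\times\omega$ interchanging $1$ and $2$ in the first factor. The structure isomorphisms thus have the form $\varphi_*(\varphi_*(x,y),z)\to\varphi_*(x,\varphi_*(y,z))$, $\varphi_*(x,y)\to(\varphi t)_*(x,y)=\varphi_*(y,x)$, and $x\to\varphi^1_*(x)=\varphi_*(x,0)$. *)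

(* Defs.v *)
From mathcomp Require Import all_boot.
From mathcomp Require Import boolp classical_sets functions cardinality.

Set Implicit Arguments.
Unset Strict Implicit.
Unset Printing Implicit Defensive.

Local Open Scope classical_set_scope.

Record category := Category {
  ob :> Type;
  hom : ob -> ob -> Type;
  idm : forall x, hom x x;
  cmp : forall x y z, hom y z -> hom x y -> hom x z;
  cmp1m : forall x y (f : hom x y), cmp (idm y) f = f;
  cmpm1 : forall x y (f : hom x y), cmp f (idm x) = f;
  cmpA : forall x y z w (h : hom z w) (g : hom y z) (f : hom x y),
    cmp h (cmp g f) = cmp (cmp h g) f }.

Arguments idm {c} x.
Arguments cmp {c x y z} g f.

Notation "g ∘ f" := (cmp g f) (at level 40, left associativity).

(** Strictness conditions equate morphisms whose sources and targets agree only
    up to a provable equality of objects; [f ≡ g] says that [f] and [g] are the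
    same arrow of [C], which includes equality of sources and of targets. *)
Inductive heq (C : category) (x y : C) (f : hom x y) :
    forall x' y' : C, hom x' y' -> Prop :=
  heq_refl : heq f f.

Notation "f ≡ g" := (heq f g) (at level 70, no associativity).

Definition inverse (C : category) (x y : C) (f : hom x y) (g : hom y x) : Prop :=
  g ∘ f = idm x /\ f ∘ g = idm y.

Definition is_iso (C : category) (x y : C) (f : hom x y) : Prop :=
  exists g, inverse f g.

Record functor (C D : category) := Functor {
  fob :> C -> D;
  fmap : forall x y, hom x y -> hom (fob x) (fob y);
  fmap1 : forall x, fmap (idm x) = idm (fob x);
  fmapM : forall x y z (g : hom y z) (f : hom x y),
    fmap (g ∘ f) = fmap g ∘ fmap f }.

Arguments fmap {C D} F {x y} f : rename.

(** Equality of functors; evaluated at identities it gives equality on objects. *)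
Definition feq (C D : category) (F G : functor C D) : Prop :=
  forall (x y : C) (f : hom x y), fmap F f ≡ fmap G f.

Definition idF (C : category) : functor C C :=
  @Functor C C (fun x => x) (fun _ _ f => f)
    (fun _ => erefl) (fun _ _ _ _ _ => erefl).

Lemma fcomp_subproof1 (C D E : category) (G : functor D E) (F : functor C D) x :
  fmap G (fmap F (idm x)) = idm (G (F x)).
Proof. by rewrite !fmap1. Qed.

Lemma fcomp_subproofM (C D E : category) (G : functor D E) (F : functor C D)
    x y z (g : hom y z) (f : hom x y) :
  fmap G (fmap F (g ∘ f)) = fmap G (fmap F g) ∘ fmap G (fmap F f).
Proof. by rewrite !fmapM. Qed.

Definition fcomp (C D E : category) (G : functor D E) (F : functor C D) :
    functor C E :=
  @Functor C E (fun x => G (F x)) (fun _ _ f => fmap G (fmap F f))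
    (fcomp_subproof1 G F) (fcomp_subproofM G F).

Definition chaotic (X : Type) : category.
Proof.
refine (@Category X (fun _ _ => unit) (fun _ => tt) (fun _ _ _ _ _ => tt) _ _ _).
- by move=> x y [].
- by move=> x y [].
- by [].
Defined.

Definition prodC (C D : category) : category.
Proof.
refine (@Category (C * D)%type (fun p q => (hom p.1 q.1 * hom p.2 q.2)%type)
  (fun p => (idm p.1, idm p.2)) (fun _ _ _ g f => (g.1 ∘ f.1, g.2 ∘ f.2)) _ _ _).
- by move=> x y [f g] /=; rewrite !cmp1m.
- by move=> x y [f g] /=; rewrite !cmpm1.
- by move=> x y z w h g f /=; rewrite !cmpA.
Defined.

Definition pairm (C D : category) (x x' : C) (y y' : D)
    (f : hom x x') (g : hom y y') : @hom (prodC C D) (x, y) (x', y') := (f, g).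

(** [C^m]; the index set [{1, ..., m}] is represented by ['I_m]. *)
Definition powC (C : category) (m : nat) : category.
Proof.
refine (@Category ('I_m -> C) (fun x y => forall i, hom (x i) (y i))
  (fun x i => idm (x i)) (fun _ _ _ g f i => g i ∘ f i) _ _ _).
- by move=> x y f; apply: functional_extensionality_dep => i; exact: cmp1m.
- by move=> x y f; apply: functional_extensionality_dep => i; exact: cmpm1.
- by move=> x y z w h g f; apply: functional_extensionality_dep => i; exact: cmpA.
Defined.

Definition full (C : category) (P : C -> Prop) : category :=
  @Category {x : C | P x} (fun x y => hom (sval x) (sval y))
    (fun x => idm (sval x)) (fun _ _ _ g f => g ∘ f)
    (fun _ _ f => cmp1m f) (fun _ _ f => cmpm1 f)
    (fun _ _ _ _ h g f => cmpA h g f).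

Definition ex_ob (C : category) (P : C -> Prop) (x : C) (Px : P x) : full P :=
  exist _ x Px.

Lemma heq_ob (C : category) (x y x' y' : C) (f : hom x y) (g : hom x' y') :
  f ≡ g -> x = x' /\ y = y'.
Proof. by case. Qed.

Lemma heq_pair (C D : category) (x y x' y' : C) (z w z' w' : D)
    (f : hom x y) (f' : hom x' y') (g : hom z w) (g' : hom z' w') :
  f ≡ f' -> g ≡ g' -> pairm f g ≡ pairm f' g'.
Proof. by case; case. Qed.

Lemma heq_full (C : category) (P : C -> Prop) (x y x' y' : full P)
    (f : hom x y) (f' : hom x' y') :
  @heq C (sval x) (sval y) f (sval x') (sval y') f' -> f ≡ f'.
Proof.
case: x y x' y' f f' => [x Px] [y Py] [x' Px'] [y' Py'] /= f f' ff'.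
case: ff' Px' Py' => Px' Py'.
by rewrite (Prop_irrelevance Px' Px) (Prop_irrelevance Py' Py).
Qed.

Record injection (A : Type) := Injection {
  inj_fun :> A -> nat;
  inj_inj : injective inj_fun }.

Notation M := (injection nat).

Definition oneM : M := @Injection nat id (fun _ _ e => e).

Definition mulM (u v : M) : M :=
  @Injection nat (fun n => u (v n)) (inj_comp (inj_inj (i:=u)) (inj_inj (i:=v))).

Lemma inj_ext (A : Type) (u v : injection A) : u =1 v -> u = v.
Proof.
case: u v => [u ui] [v vi] /= /funext uv; rewrite uv in ui *.
by rewrite (Prop_irrelevance ui vi).
Qed.

Lemma mul1M u : mulM oneM u = u. Proof. exact: inj_ext. Qed.
Lemma mulM1 u : mulM u oneM = u. Proof. exact: inj_ext. Qed.
Lemma mulMA u v w : mulM u (mulM v w) = mulM (mulM u v) w.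
Proof. exact: inj_ext. Qed.

(** The action of [(v, u) : u -> v] on [f], for a functor [EM × C -> C]. *)
Definition actm (C : category) (a : functor (prodC (chaotic M) C) C)
    (u v : M) (x y : C) (f : hom x y) : hom (a (u, x)) (a (v, y)) :=
  fmap a (pairm (tt : @hom (chaotic M) u v) f).

Lemma actm1 (C : category) (a : functor (prodC (chaotic M) C) C) (u : M) (x : C) :
  actm a u u (idm x) = idm (a (u, x)).
Proof. exact: (fmap1 a (u, x)). Qed.

Lemma actm_cmp (C : category) (a : functor (prodC (chaotic M) C) C)
    (u v w : M) (x y z : C) (g : hom y z) (f : hom x y) :
  actm a u w (g ∘ f) = actm a v w g ∘ actm a u v f.
Proof.
exact: (fmapM a (pairm (tt : @hom (chaotic M) v w) g)
                (pairm (tt : @hom (chaotic M) u v) f)).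
Qed.

Record mcat := MCat {
  mcar :> category;
  act : functor (prodC (chaotic M) mcar) mcar;
  act1 : forall (x y : mcar) (f : hom x y), actm act oneM oneM f ≡ f;
  actM : forall (u v u' v' : M) (x y : mcar) (f : hom x y),
    actm act (mulM u u') (mulM v v') f ≡ actm act u v (actm act u' v' f) }.

(** [u_*] on objects, [u_*] on morphisms and [[v, u]^x]. *)
Definition star (C : mcat) (u : M) (x : C) : C := act C (u, x).
Definition starm (C : mcat) (u : M) (x y : C) (f : hom x y) :
  hom (star u x) (star u y) := actm (act C) u u f.
Definition bracket (C : mcat) (v u : M) (x : C) : hom (star u x) (star v x) :=
  actm (act C) u v (idm x).

Record mfunctor (C D : mcat) := MFunctor {
  mfun :> functor C D;
  mfun_act : forall (u v : M) (x y : C) (f : hom x y),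
    fmap mfun (actm (act C) u v f) ≡ actm (act D) u v (fmap mfun f) }.

Lemma star1 (C : mcat) (x : C) : star oneM x = x.
Proof. by have [] := heq_ob (act1 (idm x)). Qed.

Lemma starM (C : mcat) (u v : M) (x : C) : star (mulM u v) x = star u (star v x).
Proof. by have [] := heq_ob (actM u u v v (idm x)). Qed.

Lemma mfun_star (C D : mcat) (F : mfunctor C D) (u : M) (x : C) :
  F (star u x) = star u (F x).
Proof. by have [] := heq_ob (mfun_act F u u (idm x)). Qed.

Lemma starm1 (C : mcat) (u : M) (x : C) : starm u (idm x) = idm (star u x).
Proof. exact: actm1. Qed.

Lemma starmM (C : mcat) (u : M) (x y z : C) (g : hom y z) (f : hom x y) :
  starm u (g ∘ f) = starm u g ∘ starm u f.
Proof. exact: actm_cmp. Qed.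

Definition supported (C : mcat) (A : set nat) (x : C) : Prop :=
  forall u : M, (forall n, A n -> u n = n) -> star u x = x.

Definition finsupp (C : mcat) (A : set nat) (x : C) : Prop :=
  finite_set A /\ supported A x.

Definition tame (C : mcat) : Prop := forall x : C, exists A, finsupp A x.

Lemma supported_mfun (C D : mcat) (F : mfunctor C D) A (x : C) :
  supported A x -> supported A (F x).
Proof. by move=> sx u uA; rewrite -mfun_star sx. Qed.

Lemma bij_infinite (S T : set nat) : infinite_set S -> infinite_set T ->
  exists b : nat -> nat, set_bij S T b.
Proof.
move=> iS iT; apply/card_set_bijP.
have hS := eq_card_nat (countableP _) iS; have hT := eq_card_nat (countableP _) iT.
exact: card_eq_trans hS (card_esym hT).
Qed.

Lemma infinite_setC (A : set nat) : finite_set A -> infinite_set (~` A).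
Proof. by move=> fA; rewrite -setTD; exact: infinite_setD infinite_nat fA. Qed.

Lemma extend_inj (A : set nat) (f : nat -> nat) : finite_set A ->
  (forall n k, A n -> A k -> f n = f k -> n = k) ->
  exists u : M, forall n, A n -> u n = f n.
Proof.
move=> fA fi.
have [b [bf bi _]] := bij_infinite (infinite_setC fA)
  (infinite_setC (finite_image f fA)).
pose h n := if pselect (A n) then f n else b n.
have hi : injective h.
  move=> n k; rewrite /h.
  case: pselect => An; case: pselect => Ak //; first exact: fi.
  - by move=> e; case: (bf k Ak); exists n.
  - by move=> e; case: (bf n An); exists k.
  - by move=> e; apply: bi => //; exact: mem_set.
by exists (Injection hi) => n An /=; rewrite /h; case: pselect.
Qed.

Lemma star_eq (C : mcat) (A : set nat) (x : C) (u v : M) : finsupp A x ->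
  (forall n, A n -> u n = v n) -> star u x = star v x.
Proof.
move=> [fA sx] uv.
set T : set nat := u @` (~` A) `|` v @` (~` A).
have iA := infinite_setC fA.
have iT : infinite_set T.
  apply: (@sub_infinite_set _ (u @` (~` A))); first by move=> n; left.
  by rewrite (eq_finite_set (inj_card_eq _)) // => n k _ _; exact: inj_inj.
have [b [bf bi bs]] := bij_infinite iA iT.
have TA n k : A n -> T k -> u n <> k.
  move=> An [[j nAj <-]|[j nAj <-]]; last rewrite uv //.
    by move=> e; apply: nAj; rewrite -(inj_inj e).
  by move=> e; apply: nAj; rewrite -(inj_inj e).
pose h n := if pselect (A n) then u n else b n.
have hi : injective h.
  move=> n k; rewrite /h; case: pselect => An; case: pselect => Ak //.
  - exact: inj_inj.
  - by move=> e; case: (TA _ _ An (bf _ Ak)).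
  - by move=> e; case: (TA _ _ Ak (bf _ An)).
  - by move=> e; apply: bi => //; exact: mem_set.
have fac (w : M) : (forall n, A n -> w n = u n) -> (w @` (~` A) `<=` T) ->
    star w x = star (Injection hi) x.
  move=> wu wT.
  have [f fP] : exists f : nat -> nat, forall n,
      (A n -> f n = n) /\ (~ A n -> ~ A (f n) /\ b (f n) = w n).
    suff /choice[f fP] : forall n, exists m,
        (A n -> m = n) /\ (~ A n -> ~ A m /\ b m = w n) by exists f.
    move=> n.
    case: (pselect (A n)) => An; first by exists n; split.
    have [|m mA bm] := bs (w n); first by apply: wT; exists n.
    by exists m; split.
  have hf n : h (f n) = w n.
    case: (pselect (A n)) => An.
      by rewrite (fP n).1 // wu // /h; case: pselect.
    by have [nA bf'] := (fP n).2 An; rewrite /h; case: pselect.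
  have fi : injective f.
    by move=> n k e; apply: (inj_inj (i:=w)); rewrite -(hf n) -(hf k) e.
  have -> : w = mulM (Injection hi) (Injection fi).
    by apply: inj_ext => n /=; rewrite hf.
  by rewrite starM (sx (Injection fi)) // => n An /=; rewrite (fP n).1.
rewrite (fac u) ?(fac v) // => n; first by move/uv.
  by right.
by left.
Qed.

Lemma finsupp_star (C : mcat) (A : set nat) (u : M) (x : C) :
  finsupp A x -> finsupp (u @` A) (star u x).
Proof.
move=> sx; split; first exact: finite_image sx.1.
move=> v vA; rewrite -starM; apply: star_eq sx _ => n An /=.
by apply: vA; exists n.
Qed.

Lemma supportedS (C : mcat) (A B : set nat) (x : C) :
  A `<=` B -> supported A x -> supported B x.
Proof. by move=> AB sx u uB; apply: sx => n /AB; exact: uB. Qed.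

Lemma finite_bound (A : set nat) : finite_set A ->
  exists N, forall n, A n -> n < N.
Proof.
move=> /finite_seqP[s ->]; exists (\max_(i <- s) i).+1 => n /= ns.
by rewrite ltnS; exact: (@leq_bigmax_seq _ s xpredT id).
Qed.

Lemma finsuppI (C : mcat) (A B : set nat) (x : C) :
  finsupp A x -> finsupp B x -> finsupp (A `&` B) x.
Proof.
move=> sA sB; have [fA xA] := sA; have [fB xB] := sB.
split; first by apply: sub_finite_set fA => n [].
move=> u uAB.
have fAB : finite_set (A `|` B) by rewrite finite_setU.
have [N NP] : exists N, forall n, (A `|` B `|` u @` A) n -> n < N.
  by apply: finite_bound; rewrite finite_setU; split=> //; exact: finite_image.
have far n k : (A `|` B `|` u @` A) k -> k <> n + N.
  by move=> /NP kN e; move: kN; rewrite e ltnNge leq_addl.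
have ext (w : M) : (forall n, A n -> (A `|` B `|` u @` A) (w n)) ->
    exists r : M, (forall n, A n -> r n = w n) /\
                  (forall n, B n -> ~ A n -> r n = n + N).
  move=> wb; pose f n := if pselect (A n) then w n else n + N.
  have [r rP] : exists r : M, forall n, (A `|` B) n -> r n = f n.
    apply: extend_inj => // n k _ _; rewrite /f.
    case: pselect => An; case: pselect => Ak //.
    - exact: inj_inj.
    - by move/far; case; exact: wb.
    - by move/esym/far; case; exact: wb.
    - exact: addIn.
  exists r; split=> n Hn; first by rewrite rP /f; [case: pselect|left].
  by move=> nA; rewrite rP /f; [case: pselect|right].
have [|r [rA rB]] := ext u; first by move=> n An; right; exists n.
have [|r' [rA' rB']] := ext oneM; first by move=> n An; left; left.
have -> : star u x = star r x by apply: star_eq sA _ => n /rA.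
have -> : star r x = star r' x.
  apply: star_eq sB _ => n Bn; case: (pselect (A n)) => An.
    by rewrite rA // rA' // uAB.
  by rewrite rB // rB'.
exact: xA.
Qed.

(** The disjoint supporting sets are required to be finite. This is automatic for
    the supports of objects of tame categories, but it cannot be dropped: an
    injection that is the identity on [ω \ {n}] is the identity, so every object
    is supported on [ω \ {n}], and infinite supporting sets would make any two
    objects supported on [{n}] "disjointly supported". *)
Definition disj (C D : mcat) (p : prodC C D) : Prop :=
  exists A B, [/\ finsupp A p.1, finsupp B p.2 & A `&` B = set0].

Definition prodM_actm (C D : mcat)
    (p q : prodC (chaotic M) (prodC C D)) (f : hom p q) :
    @hom (prodC C D) (star p.1 p.2.1, star p.1 p.2.2)
                     (star q.1 q.2.1, star q.1 q.2.2) :=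
  (actm (act C) p.1 q.1 f.2.1, actm (act D) p.1 q.1 f.2.2).

Lemma prodM_actm1 (C D : mcat) (p : prodC (chaotic M) (prodC C D)) :
  prodM_actm (idm p) = idm _.
Proof. by congr pair; exact: actm1. Qed.

Lemma prodM_actmM (C D : mcat) (p q r : prodC (chaotic M) (prodC C D))
    (g : hom q r) (f : hom p q) :
  prodM_actm (g ∘ f) = prodM_actm g ∘ prodM_actm f.
Proof. by congr pair; exact: actm_cmp. Qed.

Definition prodM_act (C D : mcat) :
    functor (prodC (chaotic M) (prodC C D)) (prodC C D) :=
  Functor (@prodM_actm1 C D) (@prodM_actmM C D).

Lemma prodM_act1 (C D : mcat) (x y : prodC C D) (f : hom x y) :
  actm (prodM_act C D) oneM oneM f ≡ f.
Proof.
by case: x y f => [x x'] [y y'] [f f']; apply: heq_pair; exact: act1.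
Qed.

Lemma prodM_actM (C D : mcat) (u v u' v' : M) (x y : prodC C D) (f : hom x y) :
  actm (prodM_act C D) (mulM u u') (mulM v v') f ≡
  actm (prodM_act C D) u v (actm (prodM_act C D) u' v' f).
Proof.
by case: x y f => [x x'] [y y'] [f f']; apply: heq_pair; exact: actM.
Qed.

Definition prodM (C D : mcat) : mcat :=
  MCat (@prodM_act1 C D) (@prodM_actM C D).

Section FullM.
Variables (C : mcat) (P : C -> Prop).
Hypothesis Pact : forall u x, P x -> P (star u x).

Definition fullM_actm (p q : prodC (chaotic M) (full P)) (f : hom p q) :
    @hom (full P) (ex_ob (Pact p.1 (svalP p.2))) (ex_ob (Pact q.1 (svalP q.2))) :=
  @actm C (act C) p.1 q.1 (sval p.2) (sval q.2) f.2.

Lemma fullM_actm1 (p : prodC (chaotic M) (full P)) :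
  fullM_actm (idm p) = idm _.
Proof. exact: actm1. Qed.

Lemma fullM_actmM (p q r : prodC (chaotic M) (full P))
    (g : hom q r) (f : hom p q) :
  fullM_actm (g ∘ f) = fullM_actm g ∘ fullM_actm f.
Proof.
exact: (@actm_cmp _ _ p.1 q.1 r.1 (sval p.2) (sval q.2) (sval r.2)).
Qed.

Definition fullM_act : functor (prodC (chaotic M) (full P)) (full P) :=
  Functor fullM_actm1 fullM_actmM.

Lemma fullM_act1 (x y : full P) (f : hom x y) : actm fullM_act oneM oneM f ≡ f.
Proof. by apply: heq_full; exact: act1. Qed.

Lemma fullM_actM (u v u' v' : M) (x y : full P) (f : hom x y) :
  actm fullM_act (mulM u u') (mulM v v') f ≡
  actm fullM_act u v (actm fullM_act u' v' f).
Proof. by apply: heq_full; exact: actM. Qed.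

Definition fullM : mcat := MCat fullM_act1 fullM_actM.

End FullM.

Lemma disj_star (C D : mcat) (u : M) (p : prodM C D) :
  disj p -> disj (star u p).
Proof.
move=> [A [B [sA sB AB]]]; exists (u @` A), (u @` B); split.
- exact: finsupp_star.
- exact: finsupp_star.
- rewrite -subset0 => _ [[a Aa <-] [b Bb e]].
  have : (A `&` B) a by split; rewrite // -(inj_inj e).
  by rewrite AB.
Qed.

Definition box (C D : mcat) : mcat := fullM (@disj_star C D).

Definition box_ob (C D : mcat) (c : C) (d : D) (h : disj (c, d)) : box C D :=
  @ex_ob (prodM C D) (@disj C D) (c, d) h.

Lemma disj_mfun (C D C' D' : mcat) (F : mfunctor C C') (G : mfunctor D D')
    (p : prodC C D) : disj p -> @disj C' D' (F p.1, G p.2).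
Proof.
move=> [A [B [[fA sA] [fB sB] AB]]]; exists A, B.
by split=> //; split=> //; exact: supported_mfun.
Qed.

Definition box_map (C D C' D' : mcat) (F : mfunctor C C') (G : mfunctor D D') :
  functor (box C D) (box C' D').
Proof.
refine (@Functor (box C D) (box C' D')
  (fun p => box_ob (disj_mfun F G (svalP p)))
  (fun p q f => pairm (fmap F f.1) (fmap G f.2)) _ _).
- by move=> [[x y] h]; congr pair; exact: fmap1.
- by move=> p q r g f; congr pair; exact: fmapM.
Defined.

Definition idMF (C : mcat) : mfunctor C C :=
  @MFunctor C C (idF C) (fun u v x y f => heq_refl _).

Lemma disjC (C D : mcat) (p : prodC C D) : disj p -> @disj D C (p.2, p.1).
Proof. by move=> [A [B [sA sB AB]]]; exists B, A; split; rewrite // setIC. Qed.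

Definition boxC (C D : mcat) : functor (box C D) (box D C).
Proof.
refine (@Functor (box C D) (box D C)
  (fun p => box_ob (disjC (svalP p)))
  (fun p q f => pairm f.2 f.1) _ _).
- by move=> p; cbn.
- by move=> p q r g f; cbn.
Defined.

Lemma supported_box (C D : mcat) A (p : box C D) :
  supported A p <-> supported A (sval p).1 /\ supported A (sval p).2.
Proof.
split.
  by move=> s; split=> u /s /(congr1 sval) /= e; rewrite -{2}e.
case: p => -[c d] h [/= s1 s2] u uA.
by apply: eq_exist; exact: (congr2 pair (s1 u uA) (s2 u uA)).
Qed.

Lemma disjA2 (C D E : mcat) (p : box (box C D) E) :
  disj ((sval (sval p).1).2, (sval p).2).
Proof.
have [A [B [[fA /supported_box[_ s2]] sB AB]]] := svalP p.
by exists A, B; split.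
Qed.

Lemma disjA1 (C D E : mcat) (p : box (box C D) E) :
  @disj C (box D E) ((sval (sval p).1).1, box_ob (disjA2 p)).
Proof.
have [A [B [[fA /supported_box[s1 s2]] [fB sB] AB]]] := svalP p.
have [A1 [A2 [h1 h2 A12]]] := svalP (sval p).1.
have [f1 {}s1] := finsuppI (conj fA s1) h1.
have [f2 {}s2] := finsuppI (conj fA s2) h2.
exists (A `&` A1), (A `&` A2 `|` B); split=> //.
- split; first by rewrite finite_setU.
  by apply/supported_box; split; apply: supportedS s2 || apply: supportedS sB;
    move=> n; [left|right].
- rewrite -subset0 => n [[An A1n] [[_ A2n]|Bn]].
    by rewrite -A12.
  by rewrite -AB.
Qed.

Definition boxA (C D E : mcat) :
  functor (box (box C D) E) (box C (box D E)).
Proof.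
refine (@Functor (box (box C D) E) (box C (box D E))
  (fun p => box_ob (disjA1 p))
  (fun p q f => (f.1.1, (f.1.2, f.2))) _ _).
- by move=> p; cbn.
- by move=> p q r g f; cbn.
Defined.

(** [x] is fixed by [EM], that is, it is an equivariant functor [* -> C]. *)
Definition fixed (C : mcat) (x : C) : Prop :=
  forall u v : M, bracket v u x ≡ idm x.

Lemma fixed_supp (C : mcat) (z : C) : fixed z -> finsupp set0 z.
Proof.
move=> hz; split; first exact: finite_set0.
by move=> u _; have [] := heq_ob (hz u u).
Qed.

Lemma disj_unit (C : mcat) (tC : tame C) (z : C) (hz : fixed z) (x : C) :
  @disj C C (x, z).
Proof.
have [A sA] := tC x; exists A, set0; split; rewrite ?setI0 //.
exact: fixed_supp.
Qed.

(** [C ≅ C ⊠ * -> C ⊠ C], [x |-> (x, z)]. *)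
Definition box_unit (C : mcat) (tC : tame C) (z : C) (hz : fixed z) :
  functor C (box C C).
Proof.
refine (@Functor C (box C C)
  (fun x => box_ob (disj_unit tC hz x))
  (fun x y f => pairm f (idm z)) _ _).
- by move=> p; cbn.
- by move=> x y w g f; congr pair; rewrite cmp1m.
Defined.

(** The left unit law follows from [plus0] and [plusC]. *)
Record parsummable := Parsummable {
  pcar :> mcat;
  ptame : tame pcar;
  plus : mfunctor (box pcar pcar) pcar;
  pzero : pcar;
  pzero_fixed : fixed pzero;
  plusA : feq (fcomp plus (box_map plus (idMF pcar)))
              (fcomp plus (fcomp (box_map (idMF pcar) plus)
                                 (boxA pcar pcar pcar)));
  plusC : feq (fcomp plus (boxC pcar pcar)) plus;
  plus0 : feq (fcomp plus (box_unit ptame pzero_fixed)) (idF pcar) }.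

Arguments pzero : clear implicits.

Section Sums.
Variable C : parsummable.

Lemma supported_plus (A B : set nat) (p : box C C) :
  supported A (sval p).1 -> supported B (sval p).2 ->
  supported (A `|` B) (plus C p).
Proof.
move=> sA sB; apply: supported_mfun; apply/supported_box.
by split; [apply: supportedS sA|apply: supportedS sB]; move=> n; [left|right].
Qed.

Definition disj_supports m (x : powC C m) (A : 'I_m -> set nat) : Prop :=
  (forall i, finsupp (A i) (x i)) /\ (forall i j, i <> j -> A i `&` A j = set0).

Definition nbox (m : nat) : category :=
  full (fun x : powC C m => exists A, disj_supports x A).

Definition tl m (T : 'I_m.+1 -> Type) (x : forall i, T i) :
  forall i : 'I_m, T (lift ord0 i) := fun i => x (lift ord0 i).

Lemma disj_supports_tl m (x : powC C m.+1) A :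
  disj_supports x A -> @disj_supports m (tl x) (tl A).
Proof.
move=> [h1 h2]; split=> [i|i j ij]; first exact: h1.
by apply: h2 => /lift_inj.
Qed.

Definition nbox_tl m (x : nbox m.+1) : nbox m :=
  ex_ob (let: ex_intro A h := svalP x in ex_intro _ (tl A) (disj_supports_tl h)).

Definition supported_sum m (F : functor (nbox m) C) : Prop :=
  forall (x : nbox m) A, disj_supports (sval x) A ->
    finsupp (\bigcup_i A i) (F x).

Lemma disj_cons m (F : functor (nbox m) C) (HF : supported_sum F)
    (x : nbox m.+1) : @disj C C (sval x ord0, F (nbox_tl x)).
Proof.
have [A hA] := svalP x; exists (A ord0), (\bigcup_i tl A i); split.
- exact: hA.1.
- by apply: HF; exact: disj_supports_tl.
- rewrite -subset0 => n [A0 [i _ Ai]].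
  by rewrite -(hA.2 ord0 (lift ord0 i)).
Qed.

Definition nsum0 : functor (nbox 0) C :=
  @Functor (nbox 0) C (fun _ => pzero C) (fun _ _ _ => idm (pzero C))
    (fun _ => erefl) (fun _ _ _ _ _ => esym (cmp1m _)).

Definition nsumS m (F : functor (nbox m) C) (HF : supported_sum F) :
  functor (nbox m.+1) C.
Proof.
refine (fcomp (plus C) (@Functor (nbox m.+1) (box C C)
  (fun x => box_ob (disj_cons HF x))
  (fun x y f => pairm (f ord0)
    (fmap F (tl f : @hom (nbox m) (nbox_tl x) (nbox_tl y)))) _ _)).
- by move=> x; congr pair; exact: fmap1 F (nbox_tl x).
- move=> x y z g f; congr pair.
  exact: (fmapM F (tl g : @hom (nbox m) (nbox_tl y) (nbox_tl z))
                  (tl f : @hom (nbox m) (nbox_tl x) (nbox_tl y))).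
Defined.

Lemma supported_sum0 : supported_sum nsum0.
Proof.
move=> x A _; have [_ s] := fixed_supp (@pzero_fixed C).
split; first by apply: bigcup_finite => // -[].
exact: supportedS s.
Qed.

Lemma supported_sumS m (F : functor (nbox m) C) (HF : supported_sum F) :
  supported_sum (nsumS HF).
Proof.
move=> x A hA; split.
  by apply: bigcup_finite => [|i _]; [exact: finite_finset|exact: (hA.1 i).1].
have s := supported_plus (p := box_ob (disj_cons HF x)) (hA.1 ord0).2
  (HF (nbox_tl x) _ (disj_supports_tl hA)).2.
apply: supportedS s.
by move=> n [An|[i _ Ai]]; [exists ord0|exists (lift ord0 i)].
Qed.

Fixpoint nsum_sig m : {F : functor (nbox m) C | supported_sum F} :=
  match m with
  | 0 => exist _ nsum0 supported_sum0
  | m'.+1 => let: exist F HF := nsum_sig m' in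
             exist _ (nsumS HF) (supported_sumS HF)
  end.

(** The [m]-fold sum [x_1 + (x_2 + ... + (x_m + 0))]. *)
Definition nsum m : functor (nbox m) C := sval (nsum_sig m).

Definition slice m (chi : injection ('I_m * nat)) (i : 'I_m) : M.
Proof.
refine (@Injection nat (fun j => chi (i, j)) _).
by move=> j k e; have [] := inj_inj (i:=chi) e.
Defined.

Lemma chi_disj m (chi : injection ('I_m * nat)) (x : powC C m) :
  exists A, @disj_supports m (fun i => star (slice chi i) (x i)) A.
Proof.
have [A hA] := choice (fun i : 'I_m => @ptame C (x i)).
exists (fun i => slice chi i @` A i); split=> [i|i j ij].
  exact: finsupp_star.
rewrite -subset0 => _ [[n _ <-] [k _ e]].
by have [/esym] := inj_inj (i:=chi) e.
Qed.

Definition chi_fam m (chi : injection ('I_m * nat)) (x : powC C m) : nbox m :=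
  ex_ob (chi_disj chi x).

Definition chi_famF m (chi : injection ('I_m * nat)) :
  functor (powC C m) (nbox m).
Proof.
refine (@Functor (powC C m) (nbox m) (chi_fam chi)
  (fun x y f i => starm (slice chi i) (f i)) _ _).
- by move=> x; apply: functional_extensionality_dep => i; exact: starm1.
- by move=> x y z g f; apply: functional_extensionality_dep => i; exact: starmM.
Defined.

Definition chi_star m (chi : injection ('I_m * nat)) : functor (powC C m) C :=
  fcomp (nsum m) (chi_famF chi).

Definition chi_bracket m (psi chi : injection ('I_m * nat)) (x : powC C m) :
    hom (chi_star chi x) (chi_star psi x) :=
  fmap (nsum m) ((fun i => bracket (slice psi i) (slice chi i) (x i))
                 : @hom (nbox m) (chi_fam chi x) (chi_fam psi x)).

Definition fam2 (x y : C) : powC C 2 :=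
  fun i => if (i : nat) is 0 then x else y.
Definition fam3 (x y z : C) : powC C 3 :=
  fun i => match (i : nat) with 0 => x | 1 => y | _ => z end.

Definition pairF : functor (prodC C C) (powC C 2).
Proof.
refine (@Functor (prodC C C) (powC C 2) (fun p => fam2 p.1 p.2)
  (fun p q f => ((fun i => match (i : nat) as n
      return hom (if n is 0 then p.1 else p.2) (if n is 0 then q.1 else q.2)
      with 0 => f.1 | _ => f.2 end)
    : @hom (powC C 2) (fam2 p.1 p.2) (fam2 q.1 q.2))) _ _).
- by move=> p; apply: functional_extensionality_dep => -[[|[]]].
- by move=> p q r g f; apply: functional_extensionality_dep => -[[|[]]].
Defined.

Definition phi_star (phi : injection ('I_2 * nat)) : functor (prodC C C) C :=
  fcomp (chi_star phi) pairF.

End Sums.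

Notation i1 := (@Ordinal 2 0 isT).
Notation i2 := (@Ordinal 2 1 isT).

Lemma inj_pair m (chi : injection ('I_m * nat)) i k j l :
  chi (i, k) = chi (j, l) -> i = j /\ k = l.
Proof. by move=> e; have [] := inj_inj (i:=chi) e. Qed.

(** [φ(φ+1)], [φ(1+φ)] and [φt]. *)
Definition phi_phi_1 (phi : injection ('I_2 * nat)) : injection ('I_3 * nat).
Proof.
refine (@Injection ('I_3 * nat) (fun p => match (p.1 : nat) with
  | 0 => phi (i1, phi (i1, p.2))
  | 1 => phi (i1, phi (i2, p.2))
  | _ => phi (i2, p.2)
  end) _).
move=> [[[|[|[|//]]] hi] j] [[[|[|[|//]]] hk] l] //=
  => /inj_pair[// _]; try move=> /inj_pair[// _]; move=> ->;
  by congr pair; exact: val_inj.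
Defined.

Definition phi_1_phi (phi : injection ('I_2 * nat)) : injection ('I_3 * nat).
Proof.
refine (@Injection ('I_3 * nat) (fun p => match (p.1 : nat) with
  | 0 => phi (i1, p.2)
  | 1 => phi (i2, phi (i1, p.2))
  | _ => phi (i2, phi (i2, p.2))
  end) _).
move=> [[[|[|[|//]]] hi] j] [[[|[|[|//]]] hk] l] //=
  => /inj_pair[// _]; try move=> /inj_pair[// _]; move=> ->;
  by congr pair; exact: val_inj.
Defined.

Definition phi_t (phi : injection ('I_2 * nat)) : injection ('I_2 * nat).
Proof.
refine (@Injection ('I_2 * nat)
  (fun p => phi (if (p.1 : nat) is 0 then i2 else i1, p.2)) _).
move=> [[[|[|//]] hi] j] [[[|[|//]] hk] l] //= /inj_pair[// _ ->];
  by congr pair; exact: val_inj.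
Defined.

Definition tensm (C : category) (T : functor (prodC C C) C) (x x' y y' : C)
    (f : hom x x') (g : hom y y') : hom (T (x, y)) (T (x', y')) :=
  fmap T (pairm f g).

(** A symmetric monoidal structure with tensor product [T] and unit object [e];
    the unit isomorphisms point from [x] to [e ⊗ x] and to [x ⊗ e]. *)
Record symmetric_monoidal (C : category) (T : functor (prodC C C) C) (e : C) :=
    SymmetricMonoidal {
  assoc : forall x y z : C, hom (T (T (x, y), z)) (T (x, T (y, z)));
  lunit : forall x : C, hom x (T (e, x));
  runit : forall x : C, hom x (T (x, e));
  symm : forall x y : C, hom (T (x, y)) (T (y, x));
  assoc_iso : forall x y z, is_iso (assoc x y z);
  lunit_iso : forall x, is_iso (lunit x);
  runit_iso : forall x, is_iso (runit x);
  assoc_nat : forall x x' y y' z z'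
      (f : hom x x') (g : hom y y') (h : hom z z'),
    assoc x' y' z' ∘ tensm T (tensm T f g) h =
    tensm T f (tensm T g h) ∘ assoc x y z;
  lunit_nat : forall x x' (f : hom x x'),
    lunit x' ∘ f = tensm T (idm e) f ∘ lunit x;
  runit_nat : forall x x' (f : hom x x'),
    runit x' ∘ f = tensm T f (idm e) ∘ runit x;
  symm_nat : forall x x' y y' (f : hom x x') (g : hom y y'),
    symm x' y' ∘ tensm T f g = tensm T g f ∘ symm x y;
  pentagon : forall x y z w,
    tensm T (idm x) (assoc y z w) ∘ assoc x (T (y, z)) w
      ∘ tensm T (assoc x y z) (idm w) =
    assoc x y (T (z, w)) ∘ assoc (T (x, y)) z w;
  triangle : forall x y,
    assoc x e y ∘ tensm T (runit x) (idm y) = tensm T (idm x) (lunit y);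
  symmK : forall x y, symm y x ∘ symm x y = idm (T (x, y));
  hexagon : forall x y z,
    assoc y z x ∘ symm x (T (y, z)) ∘ assoc x y z =
    tensm T (idm y) (symm x z) ∘ assoc y x z ∘ tensm T (symm x y) (idm z);
  symm_unit : forall x, symm x e ∘ runit x = lunit x }.

Record strong_symmetric_monoidal (C D : category)
    (T : functor (prodC C C) C) (e : C) (T' : functor (prodC D D) D) (e' : D)
    (S : symmetric_monoidal T e) (S' : symmetric_monoidal T' e')
    (F : functor C D) := StrongSymmetricMonoidal {
  mu : forall x y : C, hom (T' (F x, F y)) (F (T (x, y)));
  eps : hom e' (F e);
  mu_iso : forall x y, is_iso (mu x y);
  eps_iso : is_iso eps;
  mu_nat : forall x x' y y' (f : hom x x') (g : hom y y'),
    mu x' y' ∘ tensm T' (fmap F f) (fmap F g) = fmap F (tensm T f g) ∘ mu x y;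
  mu_assoc : forall x y z,
    fmap F (assoc S x y z) ∘ mu (T (x, y)) z
      ∘ tensm T' (mu x y) (idm (F z)) =
    mu x (T (y, z)) ∘ tensm T' (idm (F x)) (mu y z)
      ∘ assoc S' (F x) (F y) (F z);
  mu_lunit : forall x,
    mu e x ∘ tensm T' eps (idm (F x)) ∘ lunit S' (F x) = fmap F (lunit S x);
  mu_runit : forall x,
    mu x e ∘ tensm T' (idm (F x)) eps ∘ runit S' (F x) = fmap F (runit S x);
  mu_symm : forall x y,
    fmap F (symm S x y) ∘ mu x y = mu y x ∘ symm S' (F x) (F y) }.

(** [S] is [φ^*(C)]: its associativity, symmetry and right unit isomorphisms are
    the given ones. Its left unit isomorphism is determined by [symm_unit]. *)
Definition is_phi_pullback (C : parsummable) (phi : injection ('I_2 * nat))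
    (S : symmetric_monoidal (phi_star C phi) (pzero C)) : Prop :=
  [/\ forall x y z : C,
        assoc S x y z ≡ chi_bracket (phi_1_phi phi) (phi_phi_1 phi) (fam3 x y z),
      forall x y : C, symm S x y ≡ chi_bracket (phi_t phi) phi (fam2 x y)
    & forall x : C, runit S x ≡ bracket (slice phi i1) oneM x].

(* Main.v *)
(** Arrows with disjoint supports can be added, and each pair [(u, v)] of injections
    acts on arrows, sending [f] to the action of [(v, u)] on [f]. Every arrow built
    from the structure isomorphisms and tensor products is a sum of arrows
    [actm u v f], its leaves, one for each variable, where the [u]s and the [v]s
    have disjoint ranges. Since sums of such leaves are composed leafwise, by
    [actm v w g ∘ actm u v f = actm u w (g ∘ f)], and an arrow is determined by its
    leaves, each coherence diagram reduces to comparing words in [phi^1] and [phi^2].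
    The left unit isomorphism is the composite of the right one with the symmetry,
    as [symm_unit] demands. *)

Require Import Defs.
From mathcomp Require Import all_boot.
From mathcomp Require Import boolp classical_sets cardinality.
From Stdlib Require Permutation.

Set Implicit Arguments.
Unset Strict Implicit.
Unset Printing Implicit Defensive.

Local Open Scope classical_set_scope.

(** * Equality of arrows across equal objects *)

Section Heq.
Variable C : category.

(** The brackets have ends that equal the required tensor products only provably; this transport
    gives them the required type. *)
Definition castm (x y x' y' : C) (ex : x = x') (ey : y = y') (f : hom x y) :
    hom x' y' :=
  let: erefl := ex in let: erefl := ey in f.

Lemma castm_heq (x y x' y' : C) (ex : x = x') (ey : y = y') (f : hom x y) :
  castm ex ey f ≡ f.
Proof. by case: _ / ex; case: _ / ey. Qed.

Lemma heq_castm (x y x' y' : C) (f : hom x y) (g : hom x' y') : f ≡ g ->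
  forall (ex : x = x') (ey : y = y'), castm ex ey f = g.
Proof.
case=> ex ey.
by rewrite (Prop_irrelevance ex erefl) (Prop_irrelevance ey erefl).
Qed.

Lemma heq_eq (x y : C) (f g : hom x y) : f ≡ g -> f = g.
Proof. by move/heq_castm/(_ erefl erefl). Qed.

Lemma heq_sym (x y x' y' : C) (f : hom x y) (g : hom x' y') : f ≡ g -> g ≡ f.
Proof. by case. Qed.

Lemma heq_trans (x y x' y' x'' y'' : C) (f : hom x y) (g : hom x' y')
    (k : hom x'' y'') : f ≡ g -> g ≡ k -> f ≡ k.
Proof. by move=> fg; case: fg k. Qed.

Lemma heq_iso (x y x' y' : C) (f : hom x y) (g : hom x' y') :
  f ≡ g -> is_iso g -> is_iso f.
Proof. by case. Qed.

Lemma is_iso_cmp (x y z : C) (g : hom y z) (f : hom x y) :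
  is_iso g -> is_iso f -> is_iso (g ∘ f).
Proof.
move=> [g' [g'g gg']] [f' [f'f ff']]; exists (f' ∘ g'); split.
  by rewrite -cmpA (cmpA g') g'g cmp1m.
by rewrite -cmpA (cmpA f) ff' cmp1m.
Qed.

End Heq.

(** * Disjoint supports *)

Definition apart (A B : set nat) : Prop := forall n, A n -> B n -> False.

Lemma apartI0 A B : apart A B -> A `&` B = set0.
Proof. by move=> AB; rewrite -subset0 => n [/AB]. Qed.

Lemma apart_sub A B A' B' : A' `<=` A -> B' `<=` B -> apart A B -> apart A' B'.
Proof. by move=> AA BB AB n /AA An /BB; exact: AB. Qed.

Section Support.
Variable C : mcat.

(** [U] only bounds a finite support and may be infinite: the typical bound is the range of an
    injection, so that apart ranges yield [disj]. *)
Definition fsupp_in (U : set nat) (x : C) : Prop :=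
  exists2 A, finsupp A x & A `<=` U.

Lemma fsupp_in_star (u : M) (x : C) : tame C -> fsupp_in (range u) (star u x).
Proof.
move=> /(_ x)[A Ax]; exists (u @` A); first exact: finsupp_star.
by move=> _ [n _ <-]; exists n.
Qed.

Lemma fsupp_in_disj U V (x y : C) :
  fsupp_in U x -> fsupp_in V y -> apart U V -> disj (x, y).
Proof.
move=> [A Ax AU] [B By BV] UV; exists A, B; split=> //.
by apply/apartI0/(apart_sub AU BV).
Qed.

Definition disj3 (x y z : C) : Prop := exists U V W,
  [/\ fsupp_in U x, fsupp_in V y & fsupp_in W z] /\
  [/\ apart U V, apart U W & apart V W].

Lemma disj3_swap (x y z : C) : disj3 x y z -> disj3 y x z.
Proof.
move=> [U [V [W [[sx sy sz] [UV UW VW]]]]].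
by exists V, U, W; do !split=> //; move=> n Vn /UV; exact.
Qed.

Lemma disj3_disj (x y z : C) : disj3 x y z -> disj (x, y).
Proof. by move=> [U [V [W [[sx sy _] [UV _ _]]]]]; exact: fsupp_in_disj UV. Qed.

End Support.

(** * Addition of arrows with disjoint supports *)

Section Sum.
Variable C : parsummable.

Definition psum (x y : C) (h : disj (x, y)) : C := plus C (box_ob h).

Definition padd (x x' y y' : C) (h : disj (x, y)) (h' : disj (x', y'))
    (f : hom x x') (g : hom y y') :
    hom (psum h) (psum h') :=
  fmap (plus C) (pairm f g : @hom (box C C) (box_ob h) (box_ob h')).

Arguments psum : simpl never.
Arguments padd : simpl never.

(** By proof irrelevance a sum does not depend on the proofs that its supports are disjoint. *)
Lemma padd_heq (x x' y y' z z' w w' : C)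
    (h : disj (x, y)) (h' : disj (x', y')) (k : disj (z, w)) (k' : disj (z', w'))
    (f : hom x x') (g : hom y y') (f1 : hom z z') (g1 : hom w w') :
  f ≡ f1 -> g ≡ g1 -> padd h h' f g ≡ padd k k' f1 g1.
Proof.
move=> ff1 gg1; case: ff1 k k'; case: gg1 => k k'.
by rewrite (Prop_irrelevance h k) (Prop_irrelevance h' k').
Qed.

Lemma padd_cmp (x x' x'' y y' y'' : C)
    (h : disj (x, y)) (h' : disj (x', y')) (h'' : disj (x'', y''))
    (f : hom x x') (f' : hom x' x'') (g : hom y y') (g' : hom y' y'') :
  padd h h'' (f' ∘ f) (g' ∘ g) = padd h' h'' f' g' ∘ padd h h' f g.
Proof.
exact: (fmapM (plus C) (pairm f' g' : @hom (box C C) (box_ob h') (box_ob h''))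
                       (pairm f g : @hom (box C C) (box_ob h) (box_ob h'))).
Qed.

Lemma paddC (x x' y y' : C) (h : disj (x, y)) (h' : disj (x', y'))
    (k : disj (y, x)) (k' : disj (y', x')) (f : hom x x') (g : hom y y') :
  padd h h' f g ≡ padd k k' g f.
Proof.
apply: heq_trans (plusC (pairm g f : @hom (box C C) (box_ob k) (box_ob k'))).
by apply: padd_heq.
Qed.

Lemma padd0 (x x' : C) (h : disj (x, pzero C)) (h' : disj (x', pzero C))
    (f : hom x x') : padd h h' f (idm (pzero C)) ≡ f.
Proof. by apply: heq_trans (plus0 f); apply: padd_heq. Qed.

Lemma padd0l (x x' : C) (h : disj (pzero C, x)) (h' : disj (pzero C, x'))
    (f : hom x x') : padd h h' (idm (pzero C)) f ≡ f.
Proof.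
apply: heq_trans (padd0 (disjC h) (disjC h') f); exact: paddC.
Qed.

Lemma disj3_box (x y z : C) (h : disj (x, y)) : disj3 x y z ->
  disj (box_ob h : box C C, z).
Proof.
move=> [U [V [W [[[A [fA sA] AU] [B [fB sB] BV] [D sD DW]] [UV UW VW]]]]].
exists (A `|` B), D; split=> //.
- split; first by rewrite finite_setU.
  by apply/supported_box; split;
    [apply: supportedS sA|apply: supportedS sB] => n; [left|right].
- by apply: apartI0 => n [/AU Un|/BV Vn] /DW; [exact: UW|exact: VW].
Qed.

(** [disj3] makes the triples objects of [box (box C C) C], where [plusA] applies; what remains
    differs only in proofs of disjointness. *)
Lemma paddA (x x' y y' z z' : C) (f : hom x x') (g : hom y y') (k : hom z z')
    (hxy : disj (x, y)) (hxy' : disj (x', y'))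
    (hxyz : disj (psum hxy, z)) (hxyz' : disj (psum hxy', z'))
    (hyz : disj (y, z)) (hyz' : disj (y', z'))
    (h : disj (x, psum hyz)) (h' : disj (x', psum hyz')) :
  disj3 x y z -> disj3 x' y' z' ->
  padd hxyz hxyz' (padd hxy hxy' f g) k ≡ padd h h' f (padd hyz hyz' g k).
Proof.
move=> /(disj3_box hxy) b /(disj3_box hxy') b'.
pose F : @hom (box (box C C) C) (box_ob b) (box_ob b') :=
  pairm (pairm f g : @hom (box C C) (box_ob hxy) (box_ob hxy')) k.
have e := plusA F.
apply: heq_trans (heq_trans _ e) _; first exact: padd_heq.
by apply: padd_heq => //; apply: padd_heq.
Qed.

Lemma fsupp_in_plus U V (x y : C) (h : disj (x, y)) :
  fsupp_in U x -> fsupp_in V y -> fsupp_in (U `|` V) (psum h).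
Proof.
move=> [A [fA sA] AU] [B [fB sB] BV]; exists (A `|` B); last exact: setUSS.
by split; [rewrite finite_setU|apply: supported_plus].
Qed.

Lemma disj3_psum (x y z : C) (h : disj (x, y)) :
  disj3 x y z -> disj (psum h, z).
Proof.
move=> [U [V [W [[sx sy sz] [_ UW VW]]]]].
apply: fsupp_in_disj (fsupp_in_plus h sx sy) sz _.
by move=> n [/UW|/VW]; exact.
Qed.

(** [x + (y + z) = (x + y) + z = (y + x) + z = y + (x + z)]; this lets neighbouring leaves be
    exchanged. *)
Lemma paddCA (x x' y y' z z' : C) (f : hom x x') (g : hom y y') (k : hom z z')
    (hyz : disj (y, z)) (hyz' : disj (y', z'))
    (hxz : disj (x, z)) (hxz' : disj (x', z'))
    (h : disj (x, psum hyz)) (h' : disj (x', psum hyz'))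
    (l : disj (y, psum hxz)) (l' : disj (y', psum hxz')) :
  disj3 x y z -> disj3 x' y' z' ->
  padd h h' f (padd hyz hyz' g k) ≡ padd l l' g (padd hxz hxz' f k).
Proof.
move=> d d'; have c := disj3_swap d; have c' := disj3_swap d'.
have hxy := disj3_disj d; have hxy' := disj3_disj d'.
have hyx := disj3_disj c; have hyx' := disj3_disj c'.
have e := paddA f g k (disj3_psum hxy d) (disj3_psum hxy' d') h h' d d'.
apply: heq_trans (heq_sym e) _.
have {}e := paddA g f k (disj3_psum hyx c) (disj3_psum hyx' c') l l' c c'.
by apply: heq_trans _ e; apply: padd_heq => //; exact: paddC.
Qed.

Lemma act_padd (u v : M) (x x' y y' : C) (h : disj (x, y)) (h' : disj (x', y'))
    (k : disj (star u x, star u y)) (k' : disj (star v x', star v y'))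
    (f : hom x x') (g : hom y y') :
  actm (act C) u v (padd h h' f g) ≡
  padd k k' (actm (act C) u v f) (actm (act C) u v g).
Proof.
apply: heq_trans (heq_sym (mfun_act (plus C) u v
   (pairm f g : @hom (box C C) (box_ob h) (box_ob h')))) _.
exact: padd_heq.
Qed.

Lemma act_idm0 (u v : M) : actm (act C) u v (idm (pzero C)) ≡ idm (pzero C).
Proof. exact: pzero_fixed. Qed.

(** * Arrows as sums of leaves *)

(** The injections and the arrow are kept as data, so that equality of sums can be reduced to
    equality of lists. *)
Record leaf := Leaf { lu : M; lv : M; lx : C; ly : C; lf : hom lx ly }.
Arguments Leaf lu lv {lx ly} lf.

Definition larr (l : leaf) : hom (star (lu l) (lx l)) (star (lv l) (ly l)) :=
  actm (act C) (lu l) (lv l) (lf l).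

Fixpoint ranges (s : seq M) : set nat :=
  if s is u :: s' then range u `|` ranges s' else set0.

Lemma ranges_cat s t : ranges (s ++ t) = ranges s `|` ranges t.
Proof. by elim: s => [|u s IH] /=; rewrite ?set0U // IH setUA. Qed.

Lemma ranges_mulM u s : ranges (map (mulM u) s) = u @` ranges s.
Proof.
elim: s => [|v s IH] /=; first by rewrite image_set0.
by rewrite image_setU image_comp -IH.
Qed.

Definition lsrcs (L : seq leaf) : set nat := ranges (map lu L).
Definition ltgts (L : seq leaf) : set nat := ranges (map lv L).

(** A family indexed by both ends: case analysis turns the ends of the arrow into sums without any
    transport. *)
Variant leaf_add (l : leaf) (P : forall x y : C, hom x y -> Prop) :
    forall x y : C, hom x y -> Prop :=
  LeafAdd x y (g : hom x y) (h : disj (star (lu l) (lx l), x))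
    (h' : disj (star (lv l) (ly l), y)) of P x y g :
  leaf_add l P (padd h h' (larr l) g).

(** [f] is the sum of the arrows [actm u v g] for the leaves [Leaf u v g] of [L],
    and the ranges of the [u]s are disjoint, as are those of the [v]s. *)
Fixpoint sum_of (L : seq leaf) : forall x y : C, hom x y -> Prop :=
  if L is l :: L' then fun x y f =>
    [/\ apart (range (lu l)) (lsrcs L'), apart (range (lv l)) (ltgts L') &
        leaf_add l (sum_of L') f]
  else fun x y f => idm (pzero C) ≡ f.

Arguments sum_of : simpl never.

Lemma sum_of_heq L (x y x' y' : C) (f : hom x y) (g : hom x' y') :
  f ≡ g -> sum_of L f -> sum_of L g.
Proof. by case. Qed.

Lemma sum_of_cons l L (x y : C) (f : hom x y) h h' :
  apart (range (lu l)) (lsrcs L) -> apart (range (lv l)) (ltgts L) ->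
  sum_of L f -> sum_of (l :: L) (padd h h' (larr l) f).
Proof. by split. Qed.

(** By tameness [star u x] has a finite support inside the range of [u]. These bounds show that
    further sums are defined. *)
Lemma sum_of_supp L (x y : C) (f : hom x y) :
  sum_of L f -> fsupp_in (lsrcs L) x /\ fsupp_in (ltgts L) y.
Proof.
elim: L x y f => [|l L IH] x y f.
  by case; split; exists set0 => //; apply: fixed_supp; exact: pzero_fixed.
case=> _ _; case=> {x y f} x y g h h' /IH[sx sy].
by split; apply: fsupp_in_plus => //; apply: fsupp_in_star; exact: ptame.
Qed.

(** The principle behind every coherence proof: a list of leaves fixes the arrow together with its
    source and target. *)
Lemma sum_of_uniq L (x y x' y' : C) (f : hom x y) (g : hom x' y') :
  sum_of L f -> sum_of L g -> f ≡ g.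
Proof.
elim: L x y f x' y' g => [|l L IH] x y f x' y' g.
  by move=> /heq_sym f0; exact: heq_trans.
case=> _ _; case=> {x y f} x y f h h' sf.
case=> _ _; case=> {x' y' g} x' y' g k k' sg.
by apply: padd_heq => //; exact: IH.
Qed.

Lemma sum_of_leaf (x y : C) (f : hom x y) : sum_of [:: Leaf oneM oneM f] f.
Proof.
have h := disj_unit (@ptame C) (@pzero_fixed C) (star oneM x).
have h' := disj_unit (@ptame C) (@pzero_fixed C) (star oneM y).
apply: (sum_of_heq (f := padd h h' (larr (Leaf oneM oneM f)) (idm (pzero C)))).
  by apply: heq_trans (padd0 _ _ _) _; exact: act1.
by split; [move=> ? _|move=> ? _|split].
Qed.

Lemma sum_of_nil : sum_of [::] (idm (pzero C)).
Proof. exact: heq_refl. Qed.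

Definition lact (u v : M) (l : leaf) : leaf :=
  Leaf (mulM u (lu l)) (mulM v (lv l)) (lf l).

Lemma lsrcs_lact u v L : lsrcs (map (lact u v) L) = u @` lsrcs L.
Proof. by rewrite /lsrcs -ranges_mulM -!map_comp. Qed.

Lemma ltgts_lact u v L : ltgts (map (lact u v) L) = v @` ltgts L.
Proof. by rewrite /ltgts -ranges_mulM -!map_comp. Qed.

Lemma apart_mulM (u v : M) A :
  apart (range v) A -> apart (range (mulM u v)) (u @` A).
Proof.
move=> vA _ [n _ <-] [k Ak e]; apply: (vA k) => //.
by rewrite (inj_inj e); exists n.
Qed.

(** Addition is equivariant, so the action reaches every leaf and multiplies its injections;
    multiplying by an injection keeps ranges apart. *)
Lemma sum_of_act u v L (x y : C) (f : hom x y) :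
  sum_of L f -> sum_of (map (lact u v) L) (actm (act C) u v f).
Proof.
elim: L x y f => [|l L IH] x y f.
  by case; exact: heq_sym (act_idm0 u v).
case=> al ar; case=> {x y f} x y g h h' sg.
have k : disj (star u (star (lu l) (lx l)), star u x).
  exact: (@disj_star C C u _ h).
have k' : disj (star v (star (lv l) (ly l)), star v y).
  exact: (@disj_star C C v _ h').
have k1 := k; rewrite -starM in k1; have k1' := k'; rewrite -starM in k1'.
apply: (@sum_of_heq _ _ _ _ _ _ _ _
   (@sum_of_cons (lact u v l) _ _ _ (actm (act C) u v g) k1 k1' _ _ (IH _ _ _ sg))).
- apply: heq_trans _ (heq_sym (act_padd h h' k k' _ _)).
  by apply: padd_heq => //; exact: (actM u v).
- by rewrite lsrcs_lact; exact: apart_mulM.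
- by rewrite ltgts_lact; exact: apart_mulM.
Qed.

(** Induction on [L]: the empty list stands for the zero object, and associativity moves the head
    leaf out of the sum. *)
Lemma sum_of_cat L L' (x y x' y' : C) (f : hom x y) (g : hom x' y')
    (h : disj (x, x')) (h' : disj (y, y')) :
  apart (lsrcs L) (lsrcs L') -> apart (ltgts L) (ltgts L') ->
  sum_of L f -> sum_of L' g -> sum_of (L ++ L') (padd h h' f g).
Proof.
move=> + + + sg; have [sx' sy'] := sum_of_supp sg.
elim: L x y f h h' => [|l L IH] x y f h h' al ar.
  move=> f0; case: f0 h h' => h h'.
  exact: sum_of_heq (heq_sym (padd0l h h' g)) sg.
have {}al : apart (range (lu l)) (lsrcs L') /\ apart (lsrcs L) (lsrcs L').
  by split; apply: apart_sub al => // n; [left|right].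
have {}ar : apart (range (lv l)) (ltgts L') /\ apart (ltgts L) (ltgts L').
  by split; apply: apart_sub ar => // n; [left|right].
case=> bl br lf; case: lf h h' => {x y f} x y f q q' sf h h'.
have [sx sy] := sum_of_supp sf.
have slu := fsupp_in_star (lu l) (lx l) (@ptame C).
have slv := fsupp_in_star (lv l) (ly l) (@ptame C).
have k := fsupp_in_disj sx sx' al.2; have k' := fsupp_in_disj sy sy' ar.2.
have s := IH _ _ f k k' al.2 ar.2 sf.
have [cx cy] := sum_of_supp s.
have cl : apart (range (lu l)) (lsrcs (L ++ L')).
  by rewrite /lsrcs map_cat ranges_cat => n nl [/(bl n nl)|/(al.1 n nl)].
have cr : apart (range (lv l)) (ltgts (L ++ L')).
  by rewrite /ltgts map_cat ranges_cat => n nl [/(br n nl)|/(ar.1 n nl)].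
have r := fsupp_in_disj slu cx cl; have r' := fsupp_in_disj slv cy cr.
apply: (sum_of_heq (f := padd r r' (larr l) (padd k k' f g))); last by split.
apply: heq_sym; apply: paddA.
- by exists (range (lu l)), (lsrcs L), (lsrcs L'); split; split=> //; case: al.
- by exists (range (lv l)), (ltgts L), (ltgts L'); split; split=> //; case: ar.
Qed.

Lemma ranges_perm s t n :
  Permutation.Permutation s t -> ranges s n -> ranges t n.
Proof.
elim=> [//|u s1 s2 _ IH|u v s1|s1 s2 s3 _ IH1 _ IH2].
- by case=> [?|/IH ?]; [left|right].
- by case=> [?|[?|?]]; [right; left|left|right; right].
- by move/IH1/IH2.
Qed.

Lemma sum_of_swap a b L (x y : C) (f : hom x y) :
  sum_of (a :: b :: L) f -> sum_of (b :: a :: L) f.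
Proof.
case=> al ar; case=> {x y f} x y f h h' [bl br lf].
case: lf h h' => {x y f} x y f q q' sf h h'.
have [sx sy] := sum_of_supp sf.
have sau := fsupp_in_star (lu a) (lx a) (@ptame C).
have sav := fsupp_in_star (lv a) (ly a) (@ptame C).
have sbu := fsupp_in_star (lu b) (lx b) (@ptame C).
have sbv := fsupp_in_star (lv b) (ly b) (@ptame C).
have {al}[abl al] : apart (range (lu a)) (range (lu b)) /\
    apart (range (lu a)) (lsrcs L).
  by split=> n na nb; apply: (al n na); [left|right].
have {ar}[abr ar] : apart (range (lv a)) (range (lv b)) /\
    apart (range (lv a)) (ltgts L).
  by split=> n na nb; apply: (ar n na); [left|right].
have k := fsupp_in_disj sau sx al; have k' := fsupp_in_disj sav sy ar.
have sa : sum_of (a :: L) (padd k k' (larr a) f) by exact: sum_of_cons.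
have [sax say] := sum_of_supp sa.
have bal : apart (range (lu b)) (lsrcs (a :: L)).
  by move=> n nb [/abl|/(bl n nb)//]; exact.
have bar : apart (range (lv b)) (ltgts (a :: L)).
  by move=> n nb [/abr|/(br n nb)//]; exact.
have l := fsupp_in_disj sbu sax bal; have l' := fsupp_in_disj sbv say bar.
apply: (sum_of_heq (f := padd l l' (larr b) (padd k k' (larr a) f))).
  apply: heq_sym; apply: paddCA.
  - by exists (range (lu a)), (range (lu b)), (lsrcs L).
  - by exists (range (lv a)), (range (lv b)), (ltgts L).
exact: sum_of_cons.
Qed.

(** Commutativity of addition. The inductive [Permutation] asks for no decidable equality of
    leaves. *)
Lemma sum_of_perm L L' (x y : C) (f : hom x y) :
  Permutation.Permutation L L' -> sum_of L f -> sum_of L' f.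
Proof.
move=> LL'; elim: LL' x y f => [//|l L1 L2 P IH|a b L1|L1 L2 L3 _ IH1 _ IH2] x y f.
- case=> al ar; case=> {x y f} x y g h h' sg.
  have Q := Permutation.Permutation_sym P.
  apply: sum_of_cons; last exact: IH.
    by move=> n nl /(ranges_perm (Permutation.Permutation_map lu Q)); exact: al.
  by move=> n nl /(ranges_perm (Permutation.Permutation_map lv Q)); exact: ar.
- exact: sum_of_swap.
- by move/IH1/IH2.
Qed.

Lemma sum_of_rot L L' (x y : C) (f : hom x y) :
  sum_of (L ++ L') f -> sum_of (L' ++ L) f.
Proof. exact/sum_of_perm/Permutation.Permutation_app_comm. Qed.

(** [K'] arises from [K] by replacing each leaf by a decomposition of its arrow,
    as in an iterated tensor product. *)
Inductive lexp : seq leaf -> seq leaf -> Prop :=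
| lexp_nil : lexp [::] [::]
| lexp_cons u v (x y : C) (f : hom x y) L K K' of sum_of L f & lexp K K' :
    lexp (Leaf u v f :: K) (map (lact u v) L ++ K').

Lemma lsrcs_lexp K K' : lexp K K' -> lsrcs K' `<=` lsrcs K.
Proof.
elim=> // u v x y f L {}K {}K' _ _ IH n.
rewrite {1}/lsrcs map_cat ranges_cat => -[|/IH ?]; last by right.
by rewrite -/(lsrcs _) lsrcs_lact => -[k _ <-]; left; exists k.
Qed.

Lemma ltgts_lexp K K' : lexp K K' -> ltgts K' `<=` ltgts K.
Proof.
elim=> // u v x y f L {}K {}K' _ _ IH n.
rewrite {1}/ltgts map_cat ranges_cat => -[|/IH ?]; last by right.
by rewrite -/(ltgts _) ltgts_lact => -[k _ <-]; left; exists k.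
Qed.

(** A sum of sums is flattened. The range of [mulM u u'] lies in that of [u], so the refined leaves
    stay apart. *)
Lemma sum_of_lexp K K' (x y : C) (g : hom x y) :
  lexp K K' -> sum_of K g -> sum_of K' g.
Proof.
move=> KK'; elim: KK' x y g => // u v x y f L {}K {}K' sf KK' IH x1 y1 g.
case=> al ar; case=> {x1 y1 g} x1 y1 g h h' sg.
apply: sum_of_cat; [| |exact: sum_of_act|exact: IH].
- rewrite lsrcs_lact; apply: apart_sub (lsrcs_lexp KK') al.
  by move=> _ [n _ <-]; exists n.
- rewrite ltgts_lact; apply: apart_sub (ltgts_lexp KK') ar.
  by move=> _ [n _ <-]; exists n.
Qed.

(** Leafwise composition: [L''] is [L'] after [L]. *)
Inductive lcmp : seq leaf -> seq leaf -> seq leaf -> Prop :=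
| lcmp_nil : lcmp [::] [::] [::]
| lcmp_cons u v v' w (x y z : C) (f : hom x y) (g : hom y z) L L' L''
    of v = v' & lcmp L L' L'' :
    lcmp (Leaf u v f :: L) (Leaf v' w g :: L') (Leaf u w (g ∘ f) :: L'').

(** Targets in [L] and sources in [L'] agree leaf by leaf, and they determine the middle object. *)
Lemma lcmp_ob L L' L'' (x y y' z : C) (f : hom x y) (g : hom y' z) :
  lcmp L L' L'' -> sum_of L f -> sum_of L' g -> y = y'.
Proof.
move=> c; elim: c x y y' z f g => {L L' L''}.
  by move=> x y y' z f g /heq_ob[_ <-] /heq_ob[].
move=> u v v' w x y z f g L L' L'' <- _ IH x1 y1 y2 z2 f1 g1.
case=> _ _; case=> {x1 y1 f1} x1 y1 f1 h h' sf.
case=> _ _; case=> {y2 z2 g1} y2 z2 g1 k k' sg.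
have e := IH _ _ _ _ _ _ sf sg; case: _ / e g1 k {sg} => g1 k.
by rewrite (Prop_irrelevance h' k).
Qed.

Lemma lcmp_lsrcs L L' L'' : lcmp L L' L'' -> lsrcs L'' = lsrcs L.
Proof. by elim=> // u v v' w x y z f g {}L {}L' {}L'' _ _ IH; congr (_ `|` _). Qed.

Lemma lcmp_ltgts L L' L'' : lcmp L L' L'' -> ltgts L'' = ltgts L'.
Proof. by elim=> // u v v' w x y z f g {}L {}L' {}L'' _ _ IH; congr (_ `|` _). Qed.

Lemma sum_of_cmp L L' L'' (x y z : C) (f : hom x y) (g : hom y z) :
  lcmp L L' L'' -> sum_of L f -> sum_of L' g -> sum_of L'' (g ∘ f).
Proof.
move=> c sf sg.
(* In the induction the two sums are taken apart separately, so their middle objects must be allowed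
   to differ by an equation. *)
suff gen y' (g' : hom y' z) (e : y = y') :
    sum_of L' g' -> sum_of L'' (g' ∘ castm erefl e f).
  exact: (gen _ g erefl).
elim: c x y z f y' g' e sf {g sg} => {L L' L''}.
  move=> x y z f y' g e f0 g0; case: f0 e => e; case: g0 e => e.
  by rewrite (Prop_irrelevance e erefl) /= cmp1m; exact: heq_refl.
move=> u v v' w x y z f g L L' L'' <- c IH x1 y1 z1 f1 y2 g1 e.
case=> al _ lf; case: lf e => {x1 y1 f1} x1 y1 f1 h h' sf e.
case=> _ ar lg; case: lg e => {y2 z1 g1} y2 z1 g1 k k' sg e.
have e2 := lcmp_ob c sf sg; case: _ / e2 g1 sg k e => g1 sg k.
have s := IH _ _ _ _ _ _ erefl sf sg.
rewrite (Prop_irrelevance k h') => e.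
rewrite (Prop_irrelevance e erefl) /= -padd_cmp /larr /= -actm_cmp.
apply: (@sum_of_cons (Leaf u w (g ∘ f))) => //.
- by rewrite (lcmp_lsrcs c).
- by rewrite (lcmp_ltgts c).
Qed.

(** * Leaves of the functors and brackets of an injection *)

Lemma ranges_map (I : Type) (us : I -> M) (s : seq I) n :
  ranges (map us s) n -> exists2 i, List.In i s & range (us i) n.
Proof.
elim: s => [//|i s IH] [?|/IH[j js ?]]; first by exists i => //; left.
by exists j => //; right.
Qed.

(** [nsum] is bracketed to the right and ends in the zero object, exactly as [sum_of] is. *)
Lemma sum_of_nsum m (X Y : nbox C m) (F : hom X Y) (l : 'I_m -> leaf) :
  (forall i, larr (l i) ≡ (F : @hom (powC C m) (sval X) (sval Y)) i) ->
  (forall i j, i <> j -> apart (range (lu (l i))) (range (lu (l j)))) ->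
  (forall i j, i <> j -> apart (range (lv (l i))) (range (lv (l j)))) ->
  sum_of (map l (enum 'I_m)) (fmap (nsum C m) F).
Proof.
elim: m X Y F l => [|m IH] X Y F l lF al ar.
  by rewrite enum_ord0; exact: heq_refl.
have {}IH := IH (nbox_tl X) (nbox_tl Y) (tl F) (fun i => l (lift ord0 i)).
have {IH} : sum_of [seq l (lift ord0 i) | i <- enum 'I_m]
    (fmap (nsum C m) (tl F : @hom (nbox C m) (nbox_tl X) (nbox_tl Y))).
  apply: IH => [i|i j ij|i j ij]; first exact: lF.
  - by apply: al => /lift_inj.
  - by apply: ar => /lift_inj.
have [ex ey] := heq_ob (lF ord0).
rewrite enum_ordSl /= -map_comp /nsum /=; case: (nsum_sig C m) => G HG /= s.
have h := disj_cons HG X; rewrite -{1}ex in h.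
have h' := disj_cons HG Y; rewrite -{1}ey in h'.
pose tF : @hom (nbox C m) (nbox_tl X) (nbox_tl Y) := tl F.
have e : padd h h' (larr (l ord0)) (fmap G tF) ≡
    padd (disj_cons HG X) (disj_cons HG Y) (F ord0) (fmap G tF).
  by apply: padd_heq => //; exact: lF.
apply: (sum_of_heq e); apply: sum_of_cons => // n n0.
- rewrite /lsrcs -map_comp => /ranges_map[j _]; exact: (al _ _ _ n n0).
- rewrite /ltgts -map_comp => /ranges_map[j _]; exact: (ar _ _ _ n n0).
Qed.

Lemma slice_apart m (chi : injection ('I_m * nat)) i j :
  i <> j -> apart (range (slice chi i)) (range (slice chi j)).
Proof. by move=> ij _ [n _ <-] [k _ /inj_pair[]] /esym. Qed.

Lemma sum_of_chi_bracket m (psi chi : injection ('I_m * nat)) (x : powC C m) :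
  sum_of [seq Leaf (slice chi i) (slice psi i) (idm (x i)) | i <- enum 'I_m]
    (chi_bracket psi chi x).
Proof.
apply: sum_of_nsum => [i|i j|i j]; [exact: heq_refl|exact: slice_apart..].
Qed.

Lemma sum_of_chi_star m (chi : injection ('I_m * nat)) (x y : powC C m)
    (f : hom x y) :
  sum_of [seq Leaf (slice chi i) (slice chi i) (f i) | i <- enum 'I_m]
    (fmap (chi_star C chi) f).
Proof.
apply: sum_of_nsum => [i|i j|i j]; [exact: heq_refl|exact: slice_apart..].
Qed.

Lemma enum_I2 : enum 'I_2 = [:: i1; i2].
Proof. by apply: (inj_map val_inj); rewrite val_enum_ord. Qed.

Lemma enum_I3 : enum 'I_3 =
  [:: @Ordinal 3 0 isT; @Ordinal 3 1 isT; @Ordinal 3 2 isT].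
Proof. by apply: (inj_map val_inj); rewrite val_enum_ord. Qed.

Definition slices3 (chi : injection ('I_3 * nat)) (u v w : M) : Prop :=
  [/\ slice chi (@Ordinal 3 0 isT) = u, slice chi (@Ordinal 3 1 isT) = v &
      slice chi (@Ordinal 3 2 isT) = w].

Lemma slices3_phi_phi_1 phi : slices3 (phi_phi_1 phi)
  (mulM (slice phi i1) (slice phi i1)) (mulM (slice phi i1) (slice phi i2))
  (slice phi i2).
Proof. by split; exact: inj_ext. Qed.

Lemma slices3_phi_1_phi phi : slices3 (phi_1_phi phi)
  (slice phi i1) (mulM (slice phi i2) (slice phi i1))
  (mulM (slice phi i2) (slice phi i2)).
Proof. by split; exact: inj_ext. Qed.

(** Decompositions of the three identities are taken as input because the objects may be tensor
    products themselves, as in the pentagon. *)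
Lemma sum_of_bracket3 psi chi u v w u' v' w' Lx Ly Lz (x y z : C) :
  slices3 chi u v w -> slices3 psi u' v' w' ->
  sum_of Lx (idm x) -> sum_of Ly (idm y) -> sum_of Lz (idm z) ->
  sum_of (map (lact u u') Lx ++ map (lact v v') Ly ++ map (lact w w') Lz)
    (chi_bracket psi chi (fam3 x y z)).
Proof.
move=> [<- <- <-] [<- <- <-] sx sy sz.
have := sum_of_chi_bracket psi chi (fam3 x y z).
rewrite enum_I3; apply: sum_of_lexp.
by rewrite -[X in _ ++ _ ++ X]cats0; do !constructor.
Qed.

(** * Leaves of tensor products and of the structure isomorphisms *)

Section Tensor.
Variable phi : injection ('I_2 * nat).
Notation p1 := (slice phi i1).
Notation p2 := (slice phi i2).
Notation T := (phi_star C phi).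

Lemma sum_of_tensm L L' (x x' y y' : C) (f : hom x x') (g : hom y y') :
  sum_of L f -> sum_of L' g ->
  sum_of (map (lact p1 p1) L ++ map (lact p2 p2) L') (tensm T f g).
Proof.
move=> sf sg.
have := sum_of_chi_star phi (fmap (pairF C) (pairm f g)).
rewrite enum_I2; apply: sum_of_lexp.
by rewrite -[X in _ ++ X]cats0; do !constructor.
Qed.

Lemma sum_of_idm L L' (x y : C) : sum_of L (idm x) -> sum_of L' (idm y) ->
  sum_of (map (lact p1 p1) L ++ map (lact p2 p2) L') (idm (T (x, y))).
Proof. by move=> sx sy; rewrite -fmap1; exact: sum_of_tensm. Qed.

(** With [psi] free this serves both the symmetry, where [psi] is [phi_t phi], and the comparison of
    two tensor products. *)
Lemma sum_of_bracket2 psi Lx Ly (x y : C) :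
  sum_of Lx (idm x) -> sum_of Ly (idm y) ->
  sum_of (map (lact p1 (slice psi i1)) Lx ++ map (lact p2 (slice psi i2)) Ly)
    (chi_bracket psi phi (fam2 x y)).
Proof.
move=> sx sy; have := sum_of_chi_bracket psi phi (fam2 x y).
rewrite enum_I2; apply: sum_of_lexp.
by rewrite -[X in _ ++ X]cats0; do !constructor.
Qed.

Lemma sum_of_assoc (x y z : C) (f : hom (T (T (x, y), z)) (T (x, T (y, z))))
    Lx Ly Lz :
  f ≡ chi_bracket (phi_1_phi phi) (phi_phi_1 phi) (fam3 x y z) ->
  sum_of Lx (idm x) -> sum_of Ly (idm y) -> sum_of Lz (idm z) ->
  sum_of (map (lact (mulM p1 p1) p1) Lx ++
          map (lact (mulM p1 p2) (mulM p2 p1)) Ly ++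
          map (lact p2 (mulM p2 p2)) Lz) f.
Proof.
move=> /heq_sym e sx sy sz; apply: (sum_of_heq e).
apply: sum_of_bracket3 => //.
- exact: slices3_phi_phi_1.
- exact: slices3_phi_1_phi.
Qed.

Lemma sum_of_symm (x y : C) (f : hom (T (x, y)) (T (y, x))) Lx Ly :
  f ≡ chi_bracket (phi_t phi) phi (fam2 x y) ->
  sum_of Lx (idm x) -> sum_of Ly (idm y) ->
  sum_of (map (lact p1 p2) Lx ++ map (lact p2 p1) Ly) f.
Proof.
move=> /heq_sym e sx sy; apply: (sum_of_heq e).
have := sum_of_bracket2 (phi_t phi) sx sy.
have -> : slice (phi_t phi) i1 = p2 by exact: inj_ext.
by have -> : slice (phi_t phi) i2 = p1 by exact: inj_ext.
Qed.

(** A bracket is the action of a pair of injections on an identity, so [sum_of_act] applies; the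
    unit object contributes no leaf. *)
Lemma sum_of_runit (x : C) (f : hom x (T (x, pzero C))) Lx :
  f ≡ bracket p1 oneM x -> sum_of Lx (idm x) ->
  sum_of (map (lact oneM p1) Lx) f.
Proof.
by move=> /heq_sym e sx; apply: (sum_of_heq e); exact: sum_of_act.
Qed.

End Tensor.

Lemma leaf_cons_eq (u v u' v' : M) (x y : C) (f f' : hom x y) L L' :
  u = u' -> v = v' -> f = f' -> L = L' -> Leaf u v f :: L = Leaf u' v' f' :: L'.
Proof. by move=> -> -> -> ->. Qed.

(** The equation of lists is the last premise, so that both lists are found by unification before
    they are compared. *)
Lemma sum_of_eq L L' (x y x' y' : C) (f : hom x y) (g : hom x' y') :
  sum_of L f -> sum_of L' g -> L = L' -> f ≡ g.
Proof. by move=> + + e; rewrite e; exact: sum_of_uniq. Qed.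

(** * Invertibility of the brackets *)

Lemma bracket_iso (u v : M) (x : C) : is_iso (bracket v u x).
Proof.
by exists (bracket u v x); split; rewrite /bracket -actm_cmp cmp1m actm1.
Qed.

(** [nsum] is a functor, and [[w, v]^x ∘ [v, u]^x = [w, u]^x] holds in each component. *)
Lemma chi_bracket_cmp m (chi psi om : injection ('I_m * nat)) (x : powC C m) :
  chi_bracket om psi x ∘ chi_bracket psi chi x = chi_bracket om chi x.
Proof.
pose b (ch ps : injection ('I_m * nat)) :
    @hom (nbox C m) (chi_fam ch x) (chi_fam ps x) :=
  fun i => bracket (slice ps i) (slice ch i) (x i).
have bb : b psi om ∘ b chi psi = b chi om.
  apply: functional_extensionality_dep => i.
  by rewrite /b /bracket /= -actm_cmp cmp1m.
by rewrite /chi_bracket -/(b chi om) -bb fmapM.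
Qed.

Lemma chi_bracket_id m (chi : injection ('I_m * nat)) (x : powC C m) :
  chi_bracket chi chi x = idm (chi_star C chi x).
Proof.
rewrite -(fmap1 (nsum C m)); congr (fmap (nsum C m)).
by apply: functional_extensionality_dep => i; exact: actm1.
Qed.

Lemma chi_bracket_inverse m (chi psi : injection ('I_m * nat)) (x : powC C m) :
  inverse (chi_bracket psi chi x) (chi_bracket chi psi x).
Proof. by split; rewrite chi_bracket_cmp chi_bracket_id. Qed.

Lemma chi_bracket_iso m (chi psi : injection ('I_m * nat)) (x : powC C m) :
  is_iso (chi_bracket psi chi x).
Proof. by eexists; exact: chi_bracket_inverse. Qed.

End Sum.

(** [inj_ext] closes every equation between words in the slices of [phi] and [psi]
    up to associativity, because composites of injections agree pointwise by
    computation. *)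
Ltac leaves := rewrite /=;
  repeat (apply: leaf_cons_eq;
    [exact: inj_ext|exact: inj_ext|by rewrite ?cmp1m ?cmpm1|]); reflexivity.

Ltac composable := rewrite /=;
  repeat (apply: lcmp_cons; [exact: inj_ext|]); exact: lcmp_nil.

(** The syntax of an arrow determines its leaves; [atom] handles the arrows that
    are not built by composition, tensor products and identities. *)
Ltac sums_with atom :=
  first [eassumption|
  lazymatch goal with
  | |- sum_of _ (_ ∘ _) =>
      eapply sum_of_cmp; [|sums_with atom|sums_with atom]; composable
  | |- sum_of _ (tensm _ _ _) => eapply sum_of_tensm; sums_with atom
  | |- sum_of _ (idm (fob (phi_star _ _) (_, _))) =>
      eapply sum_of_idm; sums_with atom
  | |- sum_of _ (idm (pzero _)) => exact: sum_of_nil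
  | |- _ => first [atom; sums_with atom|eapply sum_of_leaf]
  end].

(** * The symmetric monoidal category of one injection *)

Section Structure.
Variables (C : parsummable) (phi : injection ('I_2 * nat)).
Notation p1 := (slice phi i1).
Notation p2 := (slice phi i2).
Notation T := (phi_star C phi).
Notation e := (pzero C).

Lemma assoc_exists (x y z : C) :
  exists f : hom (T (T (x, y), z)) (T (x, T (y, z))),
    f ≡ chi_bracket (phi_1_phi phi) (phi_phi_1 phi) (fam3 x y z).
Proof.
have ix := sum_of_leaf (idm x); have iy := sum_of_leaf (idm y).
have iz := sum_of_leaf (idm z).
(* With both injections equal to [chi] the bracket is an endomorphism; comparing its leaves with
   those of an identity shows that the underlying objects are equal. *)
have b u v w chi (H : slices3 chi u v w) := sum_of_bracket3 H H ix iy iz.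
have bl := b _ _ _ _ (slices3_phi_phi_1 phi).
have br := b _ _ _ _ (slices3_phi_1_phi phi).
have l := sum_of_idm phi (sum_of_idm phi ix iy) iz.
have r := sum_of_idm phi ix (sum_of_idm phi iy iz).
have [|el _] := heq_ob (sum_of_eq bl l _); first by leaves.
have [|er _] := heq_ob (sum_of_eq br r _); first by leaves.
by exists (castm el er (chi_bracket (phi_1_phi phi) (phi_phi_1 phi) (fam3 x y z)));
  exact: castm_heq.
Qed.

Lemma symm_exists (x y : C) : exists f : hom (T (x, y)) (T (y, x)),
  f ≡ chi_bracket (phi_t phi) phi (fam2 x y).
Proof.
have ix := sum_of_leaf (idm x); have iy := sum_of_leaf (idm y).
have b := sum_of_bracket2 (phi_t phi) (phi_t phi) ix iy.
(* [T (y, x)] lists [y] first, while the bracket lists [x] first. *)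
have r := sum_of_rot (sum_of_idm phi iy ix).
have [|er _] := heq_ob (sum_of_eq b r _); first by leaves.
by exists (castm erefl er (chi_bracket (phi_t phi) phi (fam2 x y)));
  exact: castm_heq.
Qed.

Lemma runit_exists (x : C) : exists f : hom x (T (x, e)), f ≡ bracket p1 oneM x.
Proof.
have ix := sum_of_leaf (idm x).
have b := sum_of_act p1 p1 ix.
(* The zero object has no leaves, so [T (x, e)] and [star p1 x] have the same list. *)
have r := sum_of_idm phi ix (@sum_of_nil C).
have [|er _] := heq_ob (sum_of_eq b r _); first by leaves.
by exists (castm (star1 x) er (bracket p1 oneM x)); exact: castm_heq.
Qed.

Section Coherence.
Variables (a : forall x y z, hom (T (T (x, y), z)) (T (x, T (y, z))))
  (s : forall x y, hom (T (x, y)) (T (y, x))) (r : forall x, hom x (T (x, e))).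
Hypotheses
  (aP : forall x y z,
     a x y z ≡ chi_bracket (phi_1_phi phi) (phi_phi_1 phi) (fam3 x y z))
  (sP : forall x y, s x y ≡ chi_bracket (phi_t phi) phi (fam2 x y))
  (rP : forall x, r x ≡ bracket p1 oneM x).

Ltac atom := idtac; lazymatch goal with
  | |- sum_of _ (a _ _ _) => eapply (sum_of_assoc (aP _ _ _))
  | |- sum_of _ (s _ _) => eapply (sum_of_symm (sP _ _))
  | |- sum_of _ (r _) => eapply (sum_of_runit (rP _))
  end.
Ltac coherence :=
  apply: heq_eq; eapply sum_of_eq; [sums_with atom|sums_with atom|]; leaves.

Lemma tensor_symmetric_monoidal : exists S : symmetric_monoidal T e,
  [/\ assoc S = a, symm S = s & runit S = r].
Proof.
have rI x : is_iso (r x) by apply: heq_iso (rP x) (bracket_iso _ _ _).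
have sI x y : is_iso (s x y) by apply: heq_iso (sP x y) (chi_bracket_iso _ _ _).
have aI x y z : is_iso (a x y z).
  by apply: heq_iso (aP x y z) (chi_bracket_iso _ _ _).
unshelve eexists (@SymmetricMonoidal C T e a (fun x => s x e ∘ r x) r s
  _ _ _ _ _ _ _ _ _ _ _ _); last by split.
- exact: aI.
- by move=> x; exact: is_iso_cmp.
- exact: rI.
- by move=> x x' y y' z z' f g h; coherence.
- by move=> x x' f; coherence.
- by move=> x x' f; coherence.
- move=> x x' y y' f g.
  (* The leaf for [x] comes first in [s x y], so the tensor product of [g] and [f] needs its leaves
     in reversed order; [sums_with] finds [t] among the hypotheses. *)
  have t := sum_of_rot (sum_of_tensm phi (sum_of_leaf g) (sum_of_leaf f)).
  by coherence.
- by move=> x y z w; coherence.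
- by move=> x y; coherence.
- move=> x y.
  have t := sum_of_rot (sum_of_symm (sP y x) (sum_of_leaf _) (sum_of_leaf _)).
  by coherence.
- move=> x y z.
  (* All leaves are brought into the order [x], [y], [z]: a rotation in [t1], a swap of the first
     two in [t2] and [t3]. *)
  have ix := sum_of_leaf (idm x); have iy := sum_of_leaf (idm y).
  have iz := sum_of_leaf (idm z).
  have := sum_of_assoc (aP y z x) iy iz ix.
  rewrite catA => /sum_of_rot t1.
  have t2 := sum_of_perm (Permutation.perm_swap _ _ _)
    (sum_of_assoc (aP y x z) iy ix iz).
  have := sum_of_tensm phi iy (sum_of_symm (sP x z) ix iz).
  move=> /(sum_of_perm (Permutation.perm_swap _ _ _)) t3.
  by coherence.
- by [].
Qed.

End Coherence.

Lemma phi_pullback_exists : exists S : symmetric_monoidal T e, is_phi_pullback S.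
Proof.
pose a (x y z : C) := sval (cid (assoc_exists x y z)).
pose s (x y : C) := sval (cid (symm_exists x y)).
pose r (x : C) := sval (cid (runit_exists x)).
have aP x y z := svalP (cid (assoc_exists x y z)) : a x y z ≡ _.
have sP x y := svalP (cid (symm_exists x y)) : s x y ≡ _.
have rP x := svalP (cid (runit_exists x)) : r x ≡ _.
have [S [aS sS rS]] := tensor_symmetric_monoidal aP sP rP.
by exists S; split; rewrite ?aS ?sS ?rS.
Qed.

End Structure.

(** * Comparison of the structures of two injections *)

Section Comparison.
Variables (C : parsummable) (phi psi : injection ('I_2 * nat)).
Notation T := (phi_star C phi).
Notation T' := (phi_star C psi).
Notation e := (pzero C).
Variables (S : symmetric_monoidal T e) (S' : symmetric_monoidal T' e).
Hypotheses (pS : is_phi_pullback S) (pS' : is_phi_pullback S').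

(** The field [mu] runs from the tensor product of the target category to that of the source, so the
    inverse of [[psi, phi]] is taken. *)
Definition comparison (x y : C) : hom (T' (x, y)) (T (x, y)) :=
  chi_bracket phi psi (fam2 x y).

Let aP : forall x y z, _ := let: And3 h _ _ := pS in h.
Let sP : forall x y, _ := let: And3 _ h _ := pS in h.
Let rP : forall x, _ := let: And3 _ _ h := pS in h.
Let aP' : forall x y z, _ := let: And3 h _ _ := pS' in h.
Let sP' : forall x y, _ := let: And3 _ h _ := pS' in h.
Let rP' : forall x, _ := let: And3 _ _ h := pS' in h.

Ltac atom := idtac; lazymatch goal with
  | |- sum_of _ (assoc S _ _ _) => eapply (sum_of_assoc (aP _ _ _))
  | |- sum_of _ (symm S _ _) => eapply (sum_of_symm (sP _ _))
  | |- sum_of _ (runit S _) => eapply (sum_of_runit (rP _))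
  | |- sum_of _ (assoc S' _ _ _) => eapply (sum_of_assoc (aP' _ _ _))
  | |- sum_of _ (symm S' _ _) => eapply (sum_of_symm (sP' _ _))
  | |- sum_of _ (runit S' _) => eapply (sum_of_runit (rP' _))
  | |- sum_of _ (comparison _ _) => eapply (sum_of_bracket2 psi phi)
  end.
Ltac coherence :=
  apply: heq_eq; eapply sum_of_eq; [sums_with atom|sums_with atom|]; leaves.

Lemma comparison_nat (x x' y y' : C) (f : hom x x') (g : hom y y') :
  comparison x' y' ∘ tensm T' f g = tensm T f g ∘ comparison x y.
Proof. coherence. Qed.

Lemma comparison_assoc (x y z : C) :
  assoc S x y z ∘ comparison (T (x, y)) z ∘ tensm T' (comparison x y) (idm z) =
  comparison x (T (y, z)) ∘ tensm T' (idm x) (comparison y z) ∘ assoc S' x y z.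
Proof. coherence. Qed.

Lemma comparison_runit (x : C) :
  comparison x e ∘ tensm T' (idm x) (idm e) ∘ runit S' x = runit S x.
Proof. coherence. Qed.

(** By [symm_unit] the left units are the right ones followed by the symmetry, whose leaves are
    known. *)
Lemma comparison_lunit (x : C) :
  comparison e x ∘ tensm T' (idm e) (idm x) ∘ lunit S' x = lunit S x.
Proof. by rewrite -!symm_unit; coherence. Qed.

Lemma comparison_symm (x y : C) :
  symm S x y ∘ comparison x y = comparison y x ∘ symm S' x y.
Proof.
have ix := sum_of_leaf (idm x); have iy := sum_of_leaf (idm y).
(* [symm S' x y] lists the leaf of [x] first, so the leaves of [comparison y x] are rotated to
   match. *)
have t : sum_of _ (comparison y x) := sum_of_rot (sum_of_bracket2 psi phi iy ix).
coherence.
Qed.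

Lemma comparison_functor : exists F : strong_symmetric_monoidal S S' (idF C),
  (forall x y, mu F x y = comparison x y) /\ eps F = idm e.
Proof.
unshelve eexists (@StrongSymmetricMonoidal C C T e T' e S S' (idF C) comparison
  (idm e) _ _ _ _ _ _ _); last by [].
- by move=> x y; exact: chi_bracket_iso.
- by exists (idm e); split; rewrite cmp1m.
- by move=> x x' y y' f g; exact: comparison_nat.
- exact: comparison_assoc.
- exact: comparison_lunit.
- exact: comparison_runit.
- exact: comparison_symm.
Qed.

End Comparison.

Theorem proposition5p6 (C : parsummable) :
  (forall phi : injection ('I_2 * nat),
     exists S : symmetric_monoidal (phi_star C phi) (pzero C),
       is_phi_pullback S) /\
  (forall (phi psi : injection ('I_2 * nat))
          (S : symmetric_monoidal (phi_star C phi) (pzero C))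
          (S' : symmetric_monoidal (phi_star C psi) (pzero C)),
     is_phi_pullback S -> is_phi_pullback S' ->
     exists F : strong_symmetric_monoidal S S' (idF C),
       (forall x y : C, inverse (chi_bracket psi phi (fam2 x y)) (mu F x y)) /\
       eps F = idm (pzero C)).
Proof.
split=> [phi|phi psi S S' pS pS']; first exact: phi_pullback_exists.
have [F [muF epsF]] := comparison_functor pS pS'.
exists F; split=> // x y; rewrite muF; exact: chi_bracket_inverse.
Qed.
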